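(* A positive integer is a Hippasus number if and only if it is a Fibonacci number.
   Context: The Fibonacci numbers are the terms of the sequence $F_0=1$, $F_1=1$, $F_n=F_{n-2}+F_{n-1}$ for $n\ge 2$. An integer $\beta\ge 1$ is called a Hippasus number if there exists an integer $\alpha\ge\beta$ such that $\beta(\beta+\alpha)-\alpha^2=(-1)^{\gamma}$ for some non-negative integer $\gamma$; any such $\alpha$ is called a Hippasus successor of $\beta$. *)

(* Defs.v *)
From Stdlib Require Export ZArith Zgcd_alt.
Open Scope Z_scope.

Definition hippasus_successor (beta alpha : Z) : Prop :=
  beta <= alpha /\
  exists gamma : Z, 0 <= gamma /\
    beta * (beta + alpha) - alpha ^ 2 = (-1) ^ gamma.

Definition hippasus (beta : Z) : Prop :=
  1 <= beta /\ exists alpha : Z, hippasus_successor beta alpha.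

(* [fibonacci] is Zgcd_alt.fibonacci : nat -> Z, with
   fibonacci 0 = fibonacci 1 = 1. *)
Definition fibonacci_number (m : Z) : Prop :=
  exists n : nat, m = fibonacci n.

(* Main.v *)
(** The form [b * (b + a) - a ^ 2] changes sign under [(b, a) |-> (a, a + b)].
    Consecutive Fibonacci numbers therefore give it the values 1 and -1
    alternately, and conversely any solution of [b * (b + a) - a ^ 2 = 1 \/ -1]
    with [1 <= b <= a] descends through [(b, a) |-> (a - b, b)] to [(1, 1)]. *)
Require Import Defs.
From Stdlib Require Import ZArith Zgcd_alt Lia.
Open Scope Z_scope.

Lemma fibonacci_SS (n : nat) :
  fibonacci (S (S n)) = fibonacci (S n) + fibonacci n.
Proof. reflexivity. Qed.

Lemma neg_one_pow_cases (k : Z) :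
  0 <= k -> (-1) ^ k = 1 \/ (-1) ^ k = -1.
Proof.
  revert k; apply natlike_ind.
  - now left.
  - intros k hk IH. rewrite Z.pow_succ_r by exact hk. lia.
Qed.

Lemma fibonacci_form (n : nat) :
  fibonacci n * (fibonacci n + fibonacci (S n)) - fibonacci (S n) ^ 2
  = (-1) ^ Z.of_nat n.
Proof.
  induction n as [|n IH]; [reflexivity|].
  rewrite Nat2Z.inj_succ, Z.pow_succ_r, <- IH, fibonacci_SS by lia.
  ring.
Qed.

Lemma fibonacci_le_succ (n : nat) : fibonacci n <= fibonacci (S n).
Proof.
  destruct n as [|n]; [easy|].
  rewrite fibonacci_SS. pose proof (fibonacci_pos n). lia.
Qed.

Lemma unit_form_consecutive_fibonacci (a b : Z) :
  1 <= b <= a ->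
  b * (b + a) - a ^ 2 = 1 \/ b * (b + a) - a ^ 2 = -1 ->
  exists n : nat, b = fibonacci n /\ a = fibonacci (S n).
Proof.
  intros hba. assert (ha : 0 <= a) by lia.
  (* Strong induction on the larger entry [a], for all [b]: the descent makes [b] the new larger
     entry. *)
  revert b hba; pattern a; revert a ha.
  apply Z_lt_induction. intros a IH b hba hform.
  destruct (Z.eq_dec a b) as [-> | hne].
  (* On the diagonal the form is [b ^ 2], which forces [b = 1]. *)
  - exists 0%nat. assert (b = 1) by nia. now subst.
  (* If [a >= 2 * b + 1], the form [b ^ 2 - a * (a - b)] is at most -5. The bound keeps the
     descended pair ordered: [a - b <= b]. *)
  - assert (h2b : a <= 2 * b) by nia.
    destruct (IH b) with (b := a - b) as [n [hn hSn]]; [lia | lia | nia |].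
    exists (S n). rewrite fibonacci_SS. lia.
Qed.

Theorem proposition0p18 :
  forall m : Z, 0 < m -> (hippasus m <-> fibonacci_number m).
Proof.
  intros m hm. split.
  - intros [_ [a [hle [k [hk hform]]]]].
    destruct (unit_form_consecutive_fibonacci a m) as [n [hn _]].
    + lia.
    + rewrite hform. now apply neg_one_pow_cases.
    + now exists n.
  - intros [n ->]. split; [lia|].
    exists (fibonacci (S n)). split; [apply fibonacci_le_succ|].
    exists (Z.of_nat n). split; [lia | apply fibonacci_form].
Qed.
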